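(* Let $S$ be a linear operator acting on a Hilbert space $\mathcal{H}$. The following statements are equivalent: (i) $S$ is essentially selfadjoint; (ii) (a) $S$ is densely defined; (b) $S\wedge S$; (c) $\overline{\operatorname{ran}M_{S,S}(\lambda)}=\mathcal{H}\times\mathcal{H}$ for a certain (and also for all) $\lambda\in\mathbb{R}$, $\lambda\neq0$; (iii) (a) $S$ is closable; (b) $S\wedge S$; (c) $\overline{\operatorname{ran}M_{S,S}(\lambda)}=\mathcal{H}\times\mathcal{H}$ for a certain (and also for all) $\lambda\in\mathbb{R}$, $\lambda\neq0$.
   Context: Hilbert spaces are real or complex. A linear operator $S$ on $\mathcal{H}$ is a linear map $S:\operatorname{dom}S\to\mathcal{H}$ defined on a linear subspace $\operatorname{dom}S\subseteq\mathcal{H}$; it is not assumed bounded, closed or densely defined unless stated. $S$ is closable if the closure of its graph is the graph of an operator, denoted $\bar S$. The adjoint $S^*$ of a densely defined $S$ has domain $\{k:\exists h'\ \forall h\in\operatorname{dom}S,\ \langle Sh,k\rangle=\langle h,h'\rangle\}$ and $S^*k:=h'$. An operator is selfadjoint if it is densely defined and equals its adjoint (with equal domains). $S$ is essentially selfadjoint if it is densely defined, closable, and $\bar S$ is selfadjoint. $S\wedge S$ means $\langle Sh,k\rangle=\langle h,Sk\rangle$ for all $h,k\in\operatorname{dom}S$. For a scalar $\lambda$, $M_{S,S}(\lambda)=\begin{pmatrix}\lambda&-S\\S&\lambda\end{pmatrix}$ is the operator on $\mathcal{H}\times\mathcal{H}$ with domain $\operatorname{dom}S\times\operatorname{dom}S$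 given by $(h,k)\mapsto(\lambda h-Sk,\ Sh+\lambda k)$. ''For a certain (and also for all) $\lambda$'' means: the statement with ''for some $\lambda$'' and the statement with ''for all $\lambda$'' are both equivalent to the other listed statements. *)

(* Defs.v *)
From HB Require Import structures.
From mathcomp Require Import all_boot all_order all_algebra.
From mathcomp Require Import complex.
From mathcomp Require Import all_classical all_reals all_analysis.

Set Implicit Arguments.
Unset Strict Implicit.
Unset Printing Implicit Defensive.

Import Order.TTheory GRing.Theory Num.Theory.
Import numFieldNormedType.Exports.

Local Open Scope classical_set_scope.
Local Open Scope ring_scope.

Variant scalar_kind := RealScalars | ComplexScalars.

Definition scalars (R : realType) (k : scalar_kind) : numFieldType :=
  match k with
  | RealScalars => R
  | ComplexScalars => R[i]%C
  end.

Definition scalars_conj (R : realType) (k : scalar_kind) :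
    scalars R k -> scalars R k :=
  match k with
  | RealScalars => idfun
  | ComplexScalars => @conjc R
  end.

(* The inner product is linear in its first argument and conj-linear in its
   second one. *)
Record hilbertSpace (K : numFieldType) (conj : K -> K) := HilbertSpace {
  hilbert_sort :> completeNormedModType K;
  inner : {dot hilbert_sort for conj};
  inner_norm : forall x : hilbert_sort, `|x| ^+ 2 = inner x x
}.

(* The values of [op_fun] outside [op_dom] carry no meaning. *)
Record linearOperator (K : numFieldType) (U : lmodType K) := LinearOperator {
  op_dom : set U;
  op_fun :> U -> U;
  op_dom0 : op_dom 0;
  op_domP : forall (a : K) (x y : U),
    op_dom x -> op_dom y -> op_dom (a *: x + y);
  op_linear : forall (a : K) (x y : U),
    op_dom x -> op_dom y -> op_fun (a *: x + y) = a *: op_fun x + op_fun y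
}.

Section Operators.
Context {K : numFieldType} {U : lmodType K}.
Implicit Type S : linearOperator U.

Definition op_graph S : set (U * U) :=
  [set p | op_dom S p.1 /\ p.2 = S p.1].

Definition op_range S : set U := S @` op_dom S.

Section MatrixOperator.
Variables (S : linearOperator U) (lambda : K).

Definition matrix_op_dom : set (U * U) := op_dom S `*` op_dom S.

Definition matrix_op_fun (p : U * U) : U * U :=
  (lambda *: p.1 - S p.2, S p.1 + lambda *: p.2).

Lemma matrix_op_dom0 : matrix_op_dom 0.
Proof. by split; exact: op_dom0. Qed.

Lemma matrix_op_domP (a : K) (p q : U * U) :
  matrix_op_dom p -> matrix_op_dom q -> matrix_op_dom (a *: p + q).
Proof. by move=> [p1 p2] [q1 q2]; split; exact: op_domP. Qed.

Lemma matrix_op_linear (a : K) (p q : U * U) :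
  matrix_op_dom p -> matrix_op_dom q ->
  matrix_op_fun (a *: p + q) = a *: matrix_op_fun p + matrix_op_fun q.
Proof.
move=> [p1 p2] [q1 q2]; rewrite /matrix_op_fun /=.
rewrite !op_linear //; congr pair => /=.
  rewrite scalerBr scalerDr opprD !scalerA [lambda * a]mulrC.
  by rewrite addrACA.
by rewrite !scalerDr !scalerA [lambda * a]mulrC addrACA.
Qed.

Definition matrix_op : linearOperator (U * U)%type :=
  LinearOperator matrix_op_dom0 matrix_op_domP matrix_op_linear.

End MatrixOperator.
End Operators.

Section HilbertOperators.
Context {K : numFieldType} {conj : K -> K} {H : hilbertSpace conj}.
Implicit Type S : linearOperator H.

Definition densely_defined S := dense (op_dom S).

(* The library's norm on a product is the maximum of the norms of the
   components; it is equivalent to the Hilbert norm of the product, so closures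
   are the same. *)
Definition closable S :=
  exists T : linearOperator H, op_graph T = closure (op_graph S).

Definition op_closure S (S_closable : closable S) : linearOperator H :=
  projT1 (cid S_closable).

Definition adjoint_at S (k h' : H) :=
  forall h, op_dom S h -> inner H (S h) k = inner H h h'.

Definition adjoint_dom S : set H := [set k | exists h', adjoint_at S k h'].

(* When S is densely defined, at most one h' satisfies [adjoint_at S k h']. *)
Definition adjoint_fun S (k : H) : H := xget 0 (adjoint_at S k).

Definition selfadjoint S :=
  [/\ densely_defined S, op_dom S = adjoint_dom S
    & forall k, op_dom S k -> S k = adjoint_fun S k].

Definition essentially_selfadjoint S :=
  densely_defined S /\
  exists S_closable : closable S, selfadjoint (op_closure S_closable).

(* The relation written S /\ S (with a wedge). *)
Definition self_wedge S :=
  forall h k, op_dom S h -> op_dom S k -> inner H (S h) k = inner H h (S k).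

End HilbertOperators.

(* Main.v *)
Require Import Defs.
From HB Require Import structures.
From mathcomp Require Import all_boot all_order all_algebra.
From mathcomp Require Import complex.
From mathcomp Require Import all_classical all_reals all_analysis.
From mathcomp Require Import ring.

Import Order.TTheory GRing.Theory Num.Theory.
Import numFieldNormedType.Exports.
Local Open Scope classical_set_scope.
Local Open Scope ring_scope.

Set Implicit Arguments.
Unset Strict Implicit.
Unset Printing Implicit Defensive.

(** Regard the adjoint of S as the relation [adjoint_at S k h'], whether or not
    S is densely defined.  It consists of the pairs (k, h') such that (- h', k)
    is orthogonal to the graph of S in H * H, so it is a closed linear relation,
    and S is essentially selfadjoint exactly when S is densely defined and the
    closure of its graph is this relation ([essentially_selfadjointP]).

    For real lambda, a pair (u, v) is orthogonal to the range of M(lambda) if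
    and only if S^* u = lambda v and S^* v = - lambda u.  By the projection
    theorem the range is therefore dense if and only if (0, 0) is the only pair
    of this kind ([dense_range]).

    If S is essentially selfadjoint, such a u lies in the domain of the closure
    of S, and pairing its image lambda v with v gives
    lambda |v|^2 = - lambda |u|^2, whence u = v = 0: the range is dense for
    every lambda != 0.

    Conversely, let S /\ S and let the range be dense for one lambda != 0.  The
    relation S /\ S says that the graph of S, hence its closure, is contained in
    the adjoint relation.  To see that it is all of it, take h' = S^* k and
    project (lambda k, h') on the closure of the subspace of all
    (lambda h, S h).  Orthogonality of the residual (f, f') means
    S^* f' = - lambda f, while S /\ S and h' = S^* k give S^* f = lambda f'.
    So (f, f') is orthogonal to the range, hence zero, and (k, h') is in the
    closure of the graph ([adjoint_at_closure]).

    If the domain is dense, this says that S is essentially selfadjoint.  If S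
    is closable, the same equality yields density: for z orthogonal to the
    domain, (0, z) is in the adjoint relation, hence in the closure of the
    graph, which is the graph of an operator, hence z = 0
    ([closable_densely_defined]).

    All of this is carried out over an abstract scalar field with a conjugation,
    in which nonempty sets of nonnegative scalars have infima; the real and the
    complex numbers are two instances. *)

(** * Completeness of products, closures and dense sets *)

HB.instance Definition _ (K : numFieldType) (U V : completeNormedModType K) :=
  Pointed.on (U * V)%type.

Lemma prod_cauchy_cvg (K : numFieldType) (U V : completeNormedModType K)
    (F : set_system (U * V)) :
  ProperFilter F -> cauchy F -> cvg F.
Proof.
move=> FF Fc.
have proj (W : completeType) (p : U * V -> W) :
    (forall A, entourage A ->
       entourage [set x : (U * V) * (U * V) | A (p x.1, p x.2)]) ->
    cvg (p @ F).
  move=> pc; apply: cauchy_cvg => A /pc/Fc[[P Q] [/= FP FQ] PQ].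
  exists (p @` P, p @` Q) => /=.
    by split; [apply: filterS FP | apply: filterS FQ] => x; exists x.
  by move=> [_ _] [/= [x Px <-] [y Qy <-]]; exact: (PQ (x, y)).
have c1 : cvg (fst @ F).
  apply: proj => A entA; exists (A, setT).
    by split=> //; exact: entourageT.
  by move=> [[a b] [c d]] /= [Aab _]; exists ((a, c), (b, d)).
have c2 : cvg (snd @ F).
  apply: proj => A entA; exists (setT, A).
    by split=> //; exact: entourageT.
  by move=> [[a b] [c d]] /= [_ Acd]; exists ((a, c), (b, d)).
apply/cvg_ex; exists (lim (fst @ F), lim (snd @ F)).
move=> A [[P Q] [/= /c1 FP /c2 FQ] PQ].
have FPQ : F ((fst @^-1` P) `&` (snd @^-1` Q)) by exact: filterI.
by apply: filterS FPQ => -[a b] [Pa Qb]; exact: (PQ (a, b)).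
Qed.

HB.instance Definition _ (K : numFieldType) (U V : completeNormedModType K) :=
  Uniform_isComplete.Build (U * V)%type (@prod_cauchy_cvg K U V).

Lemma closure_image (X Y : topologicalType) (f : X -> Y) (A : set X) x :
  {for x, continuous f} -> closure A x -> closure (f @` A) (f x).
Proof.
by move=> fx Ax B /fx/Ax[a [Aa Ba]]; exists (f a); split=> //; exists a.
Qed.

Lemma dense_closure (X : topologicalType) (A : set X) :
  dense A <-> closure A = [set: X].
Proof.
split=> [Ad|AT O [x Ox] Oo].
  apply/seteqP; split=> // x _ B /nbhs_interior xB.
  have [|y [By Ay]] := Ad B^° _ (open_interior B).
    by exists x; exact: nbhs_singleton.
  by exists y; split=> //; exact: interior_subset.
have : closure A x by rewrite AT.
by move=> /(_ _ (open_nbhs_nbhs (conj Oo Ox)))[y [Ay Oy]]; exists y.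
Qed.

Lemma closure_normP (K : numFieldType) (V : normedModType K)
    (A : set V) x :
  closure A x <-> forall e, 0 < e -> exists2 a, A a & `|x - a| < e.
Proof.
split=> [Ax e e0|Ax B /nbhs_ballP[e /= e0 eB]].
  have /Ax[a [Aa xa]] := nbhsx_ballx x e e0.
  by exists a => //; move: xa; rewrite -ball_normE.
have [a Aa xa] := Ax e e0; exists a; split=> //.
by apply: eB; rewrite -ball_normE.
Qed.

Lemma eq0_norm_small (K : numFieldType) (a c : K) :
  0 <= c -> (forall e, 0 < e -> `|a| <= c * e) -> a = 0.
Proof.
move=> c0 ac; apply/normr0_eq0/le_anti; rewrite normr_ge0 andbT.
apply/ler_addgt0Pr => e e0; rewrite add0r.
have c1 : 0 < c + 1 by rewrite ltr_wpDl.
apply: (le_trans (ac (e / (c + 1)) _)); first exact: divr_gt0.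
by rewrite mulrCA ger_pMr// ler_pdivrMr// mul1r lerDl.
Qed.

(** * Inner products and the projection theorem *)

Section AbstractScalars.
Variables (K : numFieldType) (conj : {rmorphism K -> K}).
Hypothesis sqr_norm_conj : forall a : K, `|a| ^+ 2 = a * conj a.
Hypothesis K_inf : forall A : set K, A !=set0 -> (forall a, A a -> 0 <= a) ->
  exists m, (forall a, A a -> m <= a) /\
    forall e, 0 < e -> exists2 a, A a & a < m + e.

(** Comparing |a|^2 = a^2 with a * conj a shows that conj fixes real scalars. *)
Lemma conj_real (a : K) : a \is Num.real -> conj a = a.
Proof.
move=> ra; have := sqr_norm_conj a; rewrite real_normK // expr2.
have [-> _|a0] := eqVneq a 0; first by rewrite rmorph0.
by move/(mulfI a0).
Qed.

Section Dot.
Variables (V : lmodType K) (b : {dot V for conj}).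

Lemma dotC u v : b u v = conj (b v u).
Proof. by rewrite hermC expr0 mul1r. Qed.

Lemma dotZr a u v : b u (a *: v) = conj a * b u v.
Proof. by rewrite linearZr_LR. Qed.

Lemma dotZl a u v : b (a *: u) v = a * b u v.
Proof. by rewrite linearZl_LR. Qed.

Lemma dot_ge0 u : 0 <= b u u.
Proof.
have [->|u0] := eqVneq u 0; first by rewrite linear0l.
by rewrite ltW// neq0_dnorm_gt0.
Qed.

Lemma dot_eq0 u : b u u = 0 -> u = 0.
Proof.
by apply: contra_eq => u0; rewrite gt_eqF// neq0_dnorm_gt0.
Qed.

(** The squared distance from u to the line spanned by w, attained at the
    orthogonal projection of u. *)
Lemma dot_proj u w : w != 0 ->
  let r := u - (b u w / b w w) *: w in
  b r r = b u u - `|b u w| ^+ 2 / b w w.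
Proof.
move=> w0 r; have s_gt0 : 0 < b w w by rewrite neq0_dnorm_gt0.
rewrite /r linearBl !linearBr /= !dotZl !dotZr sqr_norm_conj.
rewrite rmorphM fmorphV /= (conj_real (ger0_real (ltW s_gt0))) (dotC w u).
by field; rewrite gt_eqF.
Qed.

Lemma dot_CauchySchwarz u w : `|b u w| ^+ 2 <= b u u * b w w.
Proof.
have [->|w0] := eqVneq w 0; first by
  rewrite linear0r normr0 expr0n mulr_ge0 ?dot_ge0.
have := dot_ge0 (u - (b u w / b w w) *: w).
by rewrite dot_proj// subr_ge0 ler_pdivrMr// neq0_dnorm_gt0.
Qed.

Lemma dot_parallelogram u v :
  b (u + v) (u + v) + b (u - v) (u - v) = 2 * b u u + 2 * b v v.
Proof. rewrite linearBl linearDl !(linearBr, linearDr) /=; ring. Qed.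

End Dot.

(** The form b need not induce the norm of V, only an equivalent one: on H * H
    the norm is the maximum of the two norms, which is not given by an inner
    product. *)
Section Projection.
Variables (V : completeNormedModType K) (b : {dot V for conj}).
Hypothesis norm_le_dot : forall v, `|v| ^+ 2 <= b v v.
Hypothesis dot_le_norm : forall v, b v v <= 2 * `|v| ^+ 2.

Lemma norm_dot_le u w : `|b u w| <= 2 * `|u| * `|w|.
Proof.
rewrite -(@ler_pXn2r _ 2)// ?nnegrE ?mulr_ge0// !exprMn.
apply: (le_trans (dot_CauchySchwarz b u w)).
apply: (le_trans (ler_pM (dot_ge0 b u) (dot_ge0 b w) (dot_le_norm u)
  (dot_le_norm w))).
rewrite le_eqVlt; apply/orP; left; apply/eqP; ring.
Qed.

Lemma orthogonal_closure (A : set V) z :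
  (forall a, A a -> b a z = 0) -> forall x, closure A x -> b x z = 0.
Proof.
move=> Az x /closure_normP Ax.
apply: (@eq0_norm_small _ _ (2 * `|z|)) => [|e e0].
  by rewrite mulr_ge0.
have [a Aa xa] := Ax e e0.
rewrite -(subrK a x) linearDl /= (Az a Aa) addr0.
by rewrite (le_trans (norm_dot_le _ _))// mulrAC ler_wpM2l ?mulr_ge0// ltW.
Qed.

(** Let m be the infimum of the squared distances from x to points of A.  The
    sets of almost minimisers have vanishing diameter by the parallelogram law,
    so they converge to a point y of the closure of A.  For an almost minimiser
    v, moving v inside A cannot lower the distance below m, so x - v is almost
    orthogonal to A; in the limit x - y is orthogonal to A. *)
Theorem orthogonal_decomposition (A : set V) (x : V) :
  A 0 -> (forall a u v, A u -> A v -> A (a *: u + v)) ->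
  exists2 y, closure A y & forall a, A a -> b a (x - y) = 0.
Proof.
move=> A0 AP.
pose D := [set b (x - v) (x - v) | v in A].
have [||m [m_le m_adh]] := @K_inf D.
- by exists (b (x - 0) (x - 0)), 0.
- by move=> _ [v _ <-]; exact: dot_ge0.
pose Am d := [set v | A v /\ b (x - v) (x - v) < m + d].
have AmP d v w : Am d v -> Am d w -> `|v - w| ^+ 2 <= 4 * d.
  move=> [Av vm] [Aw wm]; apply: (le_trans (norm_le_dot _)).
  (* the midpoint is in A, so it is no closer to x than the infimum *)
  have Amid : A (2^-1 *: (v + w)).
    have Avw : A (v + w) by rewrite -[v]scale1r; exact: AP.
    by rewrite -[_ *: _]addr0; exact: AP.
  have mid : (x - v) + (x - w) = 2 *: (x - 2^-1 *: (v + w)).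
    rewrite scalerBr scalerA divff ?pnatr_eq0// scale1r scaler_nat mulr2n.
    by rewrite opprD addrACA.
  have := dot_parallelogram b (x - w) (x - v).
  rewrite addrC [x - w + (x - v)]addrC mid.
  have -> : x - w - (x - v) = v - w by rewrite opprB addrC -addrA addKr.
  rewrite dotZl dotZr rmorph_nat => /(canRL (addrK _)) ->.
  rewrite -subr_ge0.
  set P := b (x - _ *: _) _; set Q1 := b (x - w) _; set Q2 := b (x - v) _.
  have -> : 4 * d - (2 * Q1 + 2 * Q2 - 2 * (2 * P)) =
     2 * (m + d - Q1) + 2 * (m + d - Q2) + 4 * (P - m) by ring.
  have Pm : m <= P by apply: m_le; exists (2^-1 *: (v + w)).
  by rewrite !addr_ge0// mulr_ge0// subr_ge0// ltW.
(* compare v with v + t w, the best approximation of x along w *)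
have Am_orth d v w : Am d v -> A w -> `|b (x - v) w| ^+ 2 <= d * b w w.
  move=> [Av vm] Aw; have [->|w0] := eqVneq w 0.
    by rewrite !linear0r normr0 expr0n.
  set t := b (x - v) w / b w w.
  have : m <= b (x - v - t *: w) (x - v - t *: w).
    apply: m_le; exists (t *: w + v); first exact: AP.
    by rewrite opprD addrA addrAC.
  rewrite dot_proj// lerBrDl => /le_lt_trans => /(_ _ vm).
  by rewrite addrC ltrD2l ltr_pdivrMr ?neq0_dnorm_gt0// => /ltW.
pose F := filter_from [set d : K | 0 < d] Am.
have FF : ProperFilter F.
  apply: filter_from_proper; last first.
    by move=> d /= /m_adh[_ [v Av <-] vm]; exists v.
  apply: filter_from_filter; first by exists 1 => /=.
  move=> i j /= i0 j0; have ij0 : 0 < i + j by rewrite addr_gt0.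
  (* the harmonic sum of i and j is below both *)
  exists (i * j / (i + j)); first by rewrite /= divr_gt0// mulr_gt0.
  move=> v [Av vm]; split; split=> //; apply: (lt_le_trans vm).
    by rewrite lerD2l ler_pdivrMr// ler_wpM2l ?ltW// ltrDr.
  by rewrite lerD2l ler_pdivrMr// mulrC ler_wpM2l ?ltW// ltrDl.
have /cauchy_cvg/cvg_ex[y Fy] : cauchy F.
  apply: cauchy_exP => e e0.
  (* 4 d = e^2 / 2, which makes the diameter smaller than e *)
  have d0 : 0 < e ^+ 2 / 8 by rewrite divr_gt0// exprn_gt0.
  have [_ [v Av <-] vm] := m_adh _ d0.
  have Amv : Am (e ^+ 2 / 8) v by split.
  exists v, (e ^+ 2 / 8) => //= w Aw.
  rewrite -ball_normE /= -(@ltr_pXn2r _ 2)// ?nnegrE ?(ltW e0)//.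
  apply: (le_lt_trans (AmP _ _ _ Amv Aw)).
  rewrite mulrA ltr_pdivrMr// mulrC ltr_pM2l ?exprn_gt0//.
  by rewrite ltr_nat.
have Fball e : 0 < e -> F [set v | `|y - v| < e].
  by move=> e0; have := Fy _ (nbhsx_ballx y e e0); rewrite -ball_normE.
exists y.
  apply/closure_normP => e e0.
  have F1 : F (Am 1) by exists 1 => /=.
  have [v [/= yv [Av _]]] := filter_ex (filterI (Fball _ e0) F1).
  by exists v.
move=> a Aa; rewrite dotC.
suff -> : b (x - y) a = 0 by rewrite rmorph0.
apply: (@eq0_norm_small _ _ (4 * `|a|)) => [|e e0]; first by rewrite mulr_ge0.
have Fe : F (Am (e ^+ 2)) by exists (e ^+ 2) => //=; rewrite exprn_gt0.
have [v [/= yv Amv]] := filter_ex (filterI (Fball _ e0) Fe).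
have -> : x - y = (x - v) + (v - y) by rewrite addrA subrK.
rewrite linearDl /=; apply: (le_trans (ler_normD _ _)).
have -> : 4 * `|a| * e = 2 * e * `|a| + 2 * e * `|a| by ring.
apply: lerD.
  rewrite -(@ler_pXn2r _ 2)// ?nnegrE ?mulr_ge0// ?(ltW e0)//.
  apply: (le_trans (Am_orth _ _ _ Amv Aa)).
  apply: (@le_trans _ _ (e ^+ 2 * (2 * `|a| ^+ 2))).
    by rewrite ler_wpM2l// exprn_ge0// ltW.
  have -> : (2 * e * `|a|) ^+ 2 = e ^+ 2 * (4 * `|a| ^+ 2) by ring.
  by rewrite ler_wpM2l ?exprn_ge0 ?(ltW e0)// ler_wpM2r ?exprn_ge0// ler_nat.
apply: (le_trans (norm_dot_le _ _)); rewrite ler_wpM2r// ler_wpM2l//.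
by rewrite distrC ltW.
Qed.

Lemma closure_setT_orthogonal (A : set V) :
  A 0 -> (forall a u v, A u -> A v -> A (a *: u + v)) ->
  closure A = [set: V] <-> forall z, (forall a, A a -> b a z = 0) -> z = 0.
Proof.
move=> A0 AP; split=> [AT z Az|AT].
  by apply: (@dot_eq0 _ b); apply: (orthogonal_closure Az); rewrite AT.
apply/seteqP; split=> // x _.
have [y Ay /AT xy] := orthogonal_decomposition x A0 AP.
by rewrite -(subrK y x) xy add0r.
Qed.

End Projection.

(** * The inner product of H * H *)

Section HilbertSpace.
Variable H : hilbertSpace conj.
Implicit Types (p q : H * H) (S : linearOperator H).

Definition pair_inner p q : K := inner H p.1 q.1 + inner H p.2 q.2.

Lemma pair_inner_zmodl q : zmod_morphism (pair_inner^~ q).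
Proof. by move=> p p'; rewrite /pair_inner !linearBl /= opprD addrACA. Qed.

Lemma pair_inner_zmodr p : zmod_morphism (pair_inner p).
Proof. by move=> q q'; rewrite /pair_inner !linearBr /= opprD addrACA. Qed.

Lemma pair_inner_scalel q : scalable_for *%R (pair_inner^~ q).
Proof. by move=> a p; rewrite /pair_inner /= !dotZl mulrDr. Qed.

Lemma pair_inner_scaler p : scalable_for (conj \; *%R) (pair_inner p).
Proof. by move=> a q; rewrite /pair_inner /= !dotZr mulrDr. Qed.

HB.instance Definition _ := isBilinear.Build K (H * H)%type (H * H)%type K
  *%R (conj \; *%R) pair_inner pair_inner_zmodl pair_inner_zmodr
  pair_inner_scalel pair_inner_scaler.

Lemma pair_inner_hermitian p q :
  pair_inner p q = (-1) ^+ false * conj (pair_inner q p).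
Proof.
by rewrite expr0 mul1r /pair_inner rmorphD /= -!(dotC (inner H)).
Qed.

HB.instance Definition _ := isHermitianSesquilinear.Build K (H * H)%type
  false conj pair_inner pair_inner_hermitian.

Lemma pair_inner_gt0 p : p != 0 -> 0 < pair_inner p p.
Proof.
case: p => x y xy0; rewrite /pair_inner /= -!inner_norm.
rewrite lt0r addr_ge0 ?exprn_ge0// andbT.
apply: contra xy0; rewrite paddr_eq0 ?exprn_ge0// !expf_eq0 /= !normr_eq0.
by move=> /andP[/eqP -> /eqP ->].
Qed.

HB.instance Definition _ := isDotProduct.Build K (H * H)%type pair_inner
  pair_inner_gt0.

Lemma norm_le_pair_inner p : `|p| ^+ 2 <= pair_inner p p.
Proof.
have -> : `|p| = Num.max `|p.1| `|p.2| by [].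
rewrite /pair_inner -!inner_norm /Order.max.
by case: ifP => _; rewrite ?lerDl ?lerDr exprn_ge0.
Qed.

Lemma pair_inner_le_norm p : pair_inner p p <= 2 * `|p| ^+ 2.
Proof.
have pE : `|p| = Num.max `|p.1| `|p.2| by [].
have fst_le : `|p.1| <= `|p| by rewrite pE num_le_max lexx.
have snd_le : `|p.2| <= `|p| by rewrite pE num_le_max lexx orbT.
rewrite /pair_inner -!inner_norm mulrDl mul1r.
by rewrite lerD// ler_pXn2r ?nnegrE.
Qed.

(** The bundled form, from which the results on a general form b are
    specialised: unification does not recover it from [pair_inner]. *)
Definition pair_dot : {dot (H * H)%type for conj} := pair_inner.

Lemma pair_orthogonal_closure (A : set (H * H)) q :
  (forall p, A p -> pair_inner p q = 0) ->
  forall p, closure A p -> pair_inner p q = 0.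
Proof.
exact: (@orthogonal_closure (H * H)%type pair_dot pair_inner_le_norm).
Qed.

Lemma pair_orthogonal_decomposition (A : set (H * H)) p :
  A 0 -> (forall a p q, A p -> A q -> A (a *: p + q)) ->
  exists2 q, closure A q & forall p', A p' -> pair_inner p' (p - q) = 0.
Proof.
exact: (@orthogonal_decomposition (H * H)%type pair_dot norm_le_pair_inner
  pair_inner_le_norm).
Qed.

Lemma pair_closure_setT (A : set (H * H)) :
  A 0 -> (forall a p q, A p -> A q -> A (a *: p + q)) ->
  closure A = [set: H * H] <->
  forall q, (forall p, A p -> pair_inner p q = 0) -> q = 0.
Proof.
exact: (@closure_setT_orthogonal (H * H)%type pair_dot norm_le_pair_inner
  pair_inner_le_norm).
Qed.

Lemma norm_le_inner (x : H) : `|x| ^+ 2 <= inner H x x.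
Proof. by rewrite inner_norm. Qed.

Lemma inner_le_norm (x : H) : inner H x x <= 2 * `|x| ^+ 2.
Proof. by rewrite -inner_norm ler_peMl ?exprn_ge0// ler1n. Qed.

Lemma inner_eq0 (x : H) : inner H x x = 0 -> x = 0.
Proof. exact: dot_eq0. Qed.

(** * The adjoint relation *)

Lemma op0 (U : lmodType K) (T : linearOperator U) : T 0 = 0.
Proof.
have := op_linear 1 (op_dom0 T) (op_dom0 T).
rewrite !scale1r addr0 => T0; apply: (@addrI _ (T 0)).
by rewrite -T0 addr0.
Qed.

Lemma op_range0 (U : lmodType K) (T : linearOperator U) : op_range T 0.
Proof. by exists 0; [exact: op_dom0 | exact: op0]. Qed.

Lemma op_rangeP (U : lmodType K) (T : linearOperator U) (a : K) (u v : U) :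
  op_range T u -> op_range T v -> op_range T (a *: u + v).
Proof.
move=> [x Tx <-] [y Ty <-]; exists (a *: x + y); first exact: op_domP.
exact: op_linear.
Qed.

(** The condition on a point (h, g) of the graph is orthogonality to (- h', k),
    so it extends to the closure of the graph. *)
Lemma adjoint_at_closure_graph S k h' : adjoint_at S k h' ->
  forall p, closure (op_graph S) p -> inner H p.2 k = inner H p.1 h'.
Proof.
move=> adjk p /pair_orthogonal_closure clp.
have : pair_inner p (- h', k) = 0.
  apply: clp => -[h g] [/= Sh ->].
  by rewrite /pair_inner /= linearNr (adjk _ Sh) addNr.
by rewrite /pair_inner /= linearNr addrC => /subr0_eq.
Qed.

(** S /\ S says that (h, S h) is in the adjoint relation for each h in the
    domain; extend this in its other argument to the closure of the graph. *)
Lemma closure_adjoint_at S k h' : self_wedge S ->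
  closure (op_graph S) (k, h') -> adjoint_at S k h'.
Proof.
move=> SS cl h Sh; have adjh : adjoint_at S h (S h) by move=> x Sx; exact: SS.
have /= := adjoint_at_closure_graph adjh cl.
by rewrite (dotC _ (S h)) => <-; rewrite -dotC.
Qed.

(** * The range of M(lambda) *)

(** The range is spanned by the images of the pairs (0, h), which give the first
    condition, and of the pairs (h, 0), which give the second one; as lambda is
    real, it can be moved across the inner product. *)
Lemma range_orthogonal S lambda u v : lambda \is Num.real ->
  (forall p, op_range (matrix_op S lambda) p -> pair_inner p (u, v) = 0) <->
  adjoint_at S u (lambda *: v) /\ adjoint_at S v (- lambda *: u).
Proof.
move=> lr; split=> [ran0|[adju adjv] _ [[h g] [/= Sh Sg] <-]].
  split=> h Sh.
    have /ran0 : op_range (matrix_op S lambda) (matrix_op S lambda (0, h)).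
      by exists (0, h) => //; split=> //; exact: op_dom0.
    rewrite /pair_inner /= op0 scaler0 !add0r linearNl /= dotZl dotZr.
    by rewrite conj_real// addrC => /subr0_eq.
  have /ran0 : op_range (matrix_op S lambda) (matrix_op S lambda (h, 0)).
    by exists (h, 0) => //; split=> //; exact: op_dom0.
  rewrite /pair_inner /= op0 scaler0 subr0 addr0 dotZl dotZr rmorphN.
  by rewrite conj_real// mulNr addrC => /eqP; rewrite addr_eq0 => /eqP.
rewrite /pair_inner /= linearBl linearDl /= !dotZl (adju _ Sg) (adjv _ Sh).
by rewrite !dotZr rmorphN conj_real//; ring.
Qed.

Lemma dense_range S lambda : lambda \is Num.real ->
  closure (op_range (matrix_op S lambda)) = [set: H * H] <->
  (forall u v, adjoint_at S u (lambda *: v) -> adjoint_at S v (- lambda *: u) ->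
    (u, v) = (0, 0)).
Proof.
move=> lr.
have -> := pair_closure_setT (op_range0 _) (@op_rangeP _ _).
split=> [ran0 u v adju adjv|adj0 [u v] ran0].
  by apply: ran0; apply/(range_orthogonal _ _ _ lr).
by have [adju adjv] := (range_orthogonal _ _ _ lr).1 ran0; exact: adj0.
Qed.

(** The heart of the equivalence: the residual of the projection of
    (lambda k, h') on the subspace A of all (lambda h, S h) is orthogonal to the
    range of M(lambda), so it vanishes. *)
Lemma adjoint_at_closure S lambda k h' :
  lambda \is Num.real -> lambda != 0 -> self_wedge S ->
  closure (op_range (matrix_op S lambda)) = [set: H * H] ->
  adjoint_at S k h' -> closure (op_graph S) (k, h').
Proof.
move=> lr l0 SS /(dense_range _ lr) adj0 adjk.
pose A := [set (lambda *: h, S h) | h in op_dom S].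
have A0 : A 0 by exists 0; [exact: op_dom0 | rewrite op0 scaler0].
have AP a p q : A p -> A q -> A (a *: p + q).
  move=> [x Sx <-] [y Sy <-]; exists (a *: x + y); first exact: op_domP.
  by rewrite op_linear// scalerDr !scalerA [lambda * a]mulrC -scalerA.
have [[x x'] Ax] := pair_orthogonal_decomposition (lambda *: k, h') A0 AP.
set f := lambda *: k - x; set f' := h' - x' => orthA.
have adjf' : adjoint_at S f' (- lambda *: f).
  move=> h Sh; have : pair_inner (lambda *: h, S h) (f, f') = 0.
    by apply: orthA; exists h.
  rewrite /pair_inner /= dotZl dotZr rmorphN conj_real// mulNr addrC => /eqP.
  by rewrite addr_eq0 => /eqP.
(* this equation holds for (lambda k, h') since h' = S^* k, and for (x, x')
   since S /\ S makes (S h, - lambda h) orthogonal to A *)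
have adjf : adjoint_at S f (lambda *: f').
  move=> h Sh.
  have : pair_inner (x, x') (S h, - lambda *: h) = 0.
    apply: (pair_orthogonal_closure _ Ax).
    move=> _ [g Sg <-]; rewrite /pair_inner /= dotZl dotZr rmorphN conj_real//.
    by rewrite (SS _ _ Sg Sh) mulNr subrr.
  rewrite /pair_inner /= dotZr rmorphN conj_real// mulNr => /subr0_eq xh.
  rewrite /f /f' linearBr /= !dotZr linearBr /= conj_real// adjk// mulrBr.
  congr (_ - _); rewrite dotC xh rmorphM conj_real//.
  by rewrite [in RHS]dotC.
have [/subr0_eq fE /subr0_eq f'E] := adj0 _ _ adjf adjf'.
move: Ax; rewrite -fE -f'E => Ax.
(* rescaling the first component maps A onto the graph of S *)
pose g p : H * H := (lambda^-1 *: p.1, p.2).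
have gc : continuous g.
  move=> p; apply: cvg_pair; last exact: cvg_snd.
  by apply: cvgZr; exact: cvg_fst.
have := closure_image (gc _) Ax.
rewrite /g /= scalerA mulVf// scale1r; apply: closure_subset.
by move=> _ [_ [h Sh <-] <-] /=; rewrite scalerA mulVf// scale1r; split.
Qed.

(** * Selfadjointness of the closure *)

Lemma densely_definedP S : densely_defined S <->
  forall z, (forall h, op_dom S h -> inner H h z = 0) -> z = 0.
Proof.
rewrite /densely_defined dense_closure.
apply: (closure_setT_orthogonal norm_le_inner inner_le_norm).
  exact: op_dom0.
exact: op_domP.
Qed.

Lemma adjoint_at_inj S k h1 h2 : densely_defined S ->
  adjoint_at S k h1 -> adjoint_at S k h2 -> h1 = h2.
Proof.
move=> /densely_definedP Sd a1 a2; apply/subr0_eq/Sd => h Sh.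
by rewrite linearBr /= -a1// -a2// subrr.
Qed.

Lemma adjoint_at0 S : adjoint_at S 0 0.
Proof. by move=> h _; rewrite !linear0r. Qed.

Lemma adjoint_atP S (a : K) (k1 h1 k2 h2 : H) :
  adjoint_at S k1 h1 -> adjoint_at S k2 h2 ->
  adjoint_at S (a *: k1 + k2) (a *: h1 + h2).
Proof.
by move=> a1 a2 h Sh; rewrite !linearDr /= !dotZr a1// a2.
Qed.

Lemma adjoint_funE S k h' : densely_defined S ->
  adjoint_at S k h' -> adjoint_fun S k = h'.
Proof.
move=> Sd adjk; apply: (adjoint_at_inj Sd _ adjk).
by apply: (@xgetPex _ 0 (adjoint_at S k)); exists h'.
Qed.

Section Adjoint.
Variables (S : linearOperator H) (Sd : densely_defined S).

Lemma adjoint_dom0 : adjoint_dom S 0.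
Proof. by exists 0; exact: adjoint_at0. Qed.

Lemma adjoint_domP (a : K) (x y : H) :
  adjoint_dom S x -> adjoint_dom S y -> adjoint_dom S (a *: x + y).
Proof.
by move=> [x' ax] [y' ay]; exists (a *: x' + y'); exact: adjoint_atP.
Qed.

Lemma adjoint_linear (a : K) (x y : H) :
  adjoint_dom S x -> adjoint_dom S y ->
  adjoint_fun S (a *: x + y) = a *: adjoint_fun S x + adjoint_fun S y.
Proof.
move=> [x' ax] [y' ay]; rewrite (adjoint_funE Sd ax) (adjoint_funE Sd ay).
by apply: (adjoint_funE Sd); exact: adjoint_atP.
Qed.

Definition adjoint : linearOperator H :=
  LinearOperator adjoint_dom0 adjoint_domP adjoint_linear.

Lemma adjoint_graphP k h' : op_graph adjoint (k, h') <-> adjoint_at S k h'.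
Proof.
split=> [[/= [h1 ak] ->]|ak]; first by rewrite (adjoint_funE Sd ak).
by split=> /=; [exists h' | rewrite (adjoint_funE Sd ak)].
Qed.

End Adjoint.

Lemma op_graph_dom (U : lmodType K) (T : linearOperator U) x :
  op_dom T x <-> exists y, op_graph T (x, y).
Proof. by split=> [Tx|[y []//]]; exists (T x). Qed.

Lemma op_closure_graph S (Sc : closable S) :
  op_graph (op_closure Sc) = closure (op_graph S).
Proof. exact: projT2 (cid Sc). Qed.

Lemma op_closure_adjoint_at S (Sc : closable S) k h' :
  adjoint_at (op_closure Sc) k h' <-> adjoint_at S k h'.
Proof.
have gE := op_closure_graph Sc; split=> [adjk h Sh|adjk h Th].
  have : op_graph (op_closure Sc) (h, S h).
    by rewrite gE; apply: subset_closure; split.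
  by case=> /= Th ->; exact: adjk.
apply: (adjoint_at_closure_graph adjk (p := (h, op_closure Sc h))).
by rewrite -gE; split.
Qed.

(** An operator and its closure have the same adjoint relation.  In the converse
    direction the adjoint operator itself witnesses closability, its graph being
    the closure of the graph of S. *)
Lemma essentially_selfadjointP S : essentially_selfadjoint S <->
  densely_defined S /\
  forall k h', closure (op_graph S) (k, h') <-> adjoint_at S k h'.
Proof.
split=> [[Sd [Sc [Td domE funE]]]|[Sd SE]].
  split=> // k h'; rewrite -(op_closure_adjoint_at Sc) -(op_closure_graph Sc).
  split=> [[/= Tk ->]|adjk].
    rewrite funE//; apply: (@xgetPex _ 0 (adjoint_at (op_closure Sc) k)).
    by move: Tk; rewrite domE.
  have Tk : op_dom (op_closure Sc) k by rewrite domE; exists h'.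
  by split=> //=; rewrite funE// (adjoint_funE Td adjk).
have Sc : closable S.
  exists (adjoint Sd); apply/seteqP.
  by split=> -[k h']; [move/adjoint_graphP/SE | move/SE/adjoint_graphP].
have gE := op_closure_graph Sc.
have Td : densely_defined (op_closure Sc).
  apply/densely_definedP => z Tz; apply: (densely_definedP S).1 => // h Sh.
  apply/Tz/op_graph_dom; exists (S h).
  by rewrite gE; apply: subset_closure; split.
have TE k h' : op_graph (op_closure Sc) (k, h') <->
    adjoint_at (op_closure Sc) k h'.
  by rewrite gE op_closure_adjoint_at.
split=> //; exists Sc; split=> // [|k Tk].
  apply/seteqP; split=> k; first by move=> /op_graph_dom[h' /TE]; exists h'.
  by move=> [h' /TE ?]; apply/op_graph_dom; exists h'.
by apply/esym/(adjoint_funE Td)/TE; split.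
Qed.

Lemma essentially_selfadjoint_wedge S : essentially_selfadjoint S ->
  self_wedge S.
Proof.
move=> /essentially_selfadjointP[_ SE] h k Sh Sk.
by apply: ((SE k (S k)).1 _ h Sh); apply: subset_closure; split.
Qed.

(** If (u, v) is orthogonal to the range, then (u, lambda v) is in the closure
    of the graph; pairing it with S^* v = - lambda u gives
    lambda <v, v> = - lambda <u, u>. *)
Lemma essentially_selfadjoint_range S lambda : lambda \is Num.real ->
  lambda != 0 -> essentially_selfadjoint S ->
  closure (op_range (matrix_op S lambda)) = [set: H * H].
Proof.
move=> lr l0 /essentially_selfadjointP[_ SE]; apply/(dense_range _ lr).
move=> u v adju adjv.
have := adjoint_at_closure_graph adjv ((SE _ _).2 adju).
rewrite /= dotZl dotZr rmorphN conj_real// mulNr => /eqP.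
rewrite -addr_eq0 -mulrDr mulf_eq0 (negPf l0) /=.
rewrite paddr_eq0 ?dot_ge0// => /andP[/eqP/inner_eq0 -> /eqP/inner_eq0 ->].
by [].
Qed.

(** A vector z orthogonal to the domain makes (0, z) an element of the adjoint
    relation, hence of the closure of the graph of S; for closable S this forces
    z = 0. *)
Lemma closable_densely_defined S lambda : lambda \is Num.real ->
  lambda != 0 -> self_wedge S ->
  closure (op_range (matrix_op S lambda)) = [set: H * H] ->
  closable S -> densely_defined S.
Proof.
move=> lr l0 SS rd [T gT]; apply/densely_definedP => z zS.
have : closure (op_graph S) (0, z).
  apply: (adjoint_at_closure lr l0 SS rd) => h Sh.
  by rewrite linear0r zS.
by rewrite -gT => -[_ /= ->]; exact: op0.
Qed.

Lemma densely_defined_essentially_selfadjoint S lambda :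
  lambda \is Num.real -> lambda != 0 -> self_wedge S ->
  closure (op_range (matrix_op S lambda)) = [set: H * H] ->
  densely_defined S -> essentially_selfadjoint S.
Proof.
move=> lr l0 SS rd Sd; apply/essentially_selfadjointP; split=> // k h'.
split; first exact: closure_adjoint_at.
exact: adjoint_at_closure lr l0 SS rd.
Qed.

Theorem essentially_selfadjoint_tfae S :
  [<-> essentially_selfadjoint S;
       [/\ densely_defined S, self_wedge S &
         exists lambda : K, [/\ lambda \is Num.real, lambda != 0 &
           closure (op_range (matrix_op S lambda)) = [set: H * H]]];
       [/\ densely_defined S, self_wedge S &
         forall lambda : K, lambda \is Num.real -> lambda != 0 ->
           closure (op_range (matrix_op S lambda)) = [set: H * H]];
       [/\ closable S, self_wedge S &
         exists lambda : K, [/\ lambda \is Num.real, lambda != 0 &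
           closure (op_range (matrix_op S lambda)) = [set: H * H]]];
       [/\ closable S, self_wedge S &
         forall lambda : K, lambda \is Num.real -> lambda != 0 ->
           closure (op_range (matrix_op S lambda)) = [set: H * H]]].
Proof.
have essd : essentially_selfadjoint S -> densely_defined S by case.
have essc : essentially_selfadjoint S -> closable S by move=> [_ []].
have essw := @essentially_selfadjoint_wedge S.
have essr lambda lr l0 := @essentially_selfadjoint_range S lambda lr l0.
have dess := @densely_defined_essentially_selfadjoint S.
have cess lambda lr l0 SS rd Sc :=
  dess lambda lr l0 SS rd (closable_densely_defined lr l0 SS rd Sc).
have r1 : 1 \is @Num.real K by exact: rpred1.
have n1 : 1 != 0 :> K by exact: oner_neq0.
tfae.
- move=> Se; split; [exact: essd | exact: essw |].
  by exists 1; split=> //; exact: essr.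
- move=> [Sd SS [l [lr l0 rd]]]; split=> // m mr m0.
  by apply: essr => //; exact: dess rd Sd.
- move=> [Sd SS rd]; split=> //; last by exists 1; split=> //; exact: rd.
  by apply: essc; apply: (dess 1) => //; exact: rd.
- move=> [Sc SS [l [lr l0 rd]]]; split=> // m mr m0.
  by apply: essr => //; exact: cess rd Sc.
- move=> [Sc SS rd]; exact: (cess 1 r1 n1 SS (rd 1 r1 n1) Sc).
Qed.

End HilbertSpace.
End AbstractScalars.

(** * Real and complex scalars *)

Section Scalars.
Variables (R : realType) (k : scalar_kind).
Local Notation K := (scalars R k).
Local Notation conj := (@scalars_conj R k).

Lemma conj_is_zmod_morphism : zmod_morphism conj.
Proof. by case: k => x y; [|exact: (rmorphB (@conjc R))]. Qed.

Lemma conj_is_monoid_morphism : monoid_morphism conj.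
Proof.
case: k; split=> //; first exact: (rmorph1 (@conjc R)).
exact: (rmorphM (@conjc R)).
Qed.

HB.instance Definition _ :=
  GRing.isZmodMorphism.Build K K conj conj_is_zmod_morphism.
HB.instance Definition _ :=
  GRing.isMonoidMorphism.Build K K conj conj_is_monoid_morphism.

Lemma sqr_norm_conj (a : K) : `|a| ^+ 2 = a * conj a.
Proof.
case: k a => /= a; last by rewrite sqr_normc.
by rewrite real_normK ?num_real// expr2.
Qed.

(** A nonnegative complex number is real, so the infimum can be taken among the
    real parts. *)
Lemma scalars_inf (A : set K) : A !=set0 -> (forall a, A a -> 0 <= a) ->
  exists m, (forall a, A a -> m <= a) /\
    forall e, 0 < e -> exists2 a, A a & a < m + e.
Proof.
case: k A => /= A A0 A_ge0.
  exists (inf A); split=> [a Aa|e e0].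
    by apply: ge_inf => //; exists 0 => x; exact: A_ge0.
  by apply: inf_adherent => //; split=> //; exists 0 => x; exact: A_ge0.
have Are (a : R[i]) : A a -> a = (complex.Re a)%:C%C.
  by move=> /A_ge0; case: a => a b; rewrite lecE /= => /andP[/eqP -> _].
have Alb : lbound (@complex.Re R @` A) 0.
  by move=> _ [a /A_ge0 + <-]; rewrite lecE /= => /andP[].
exists (inf (@complex.Re R @` A))%:C%C; split=> [a Aa|e e0].
  rewrite (Are a Aa) lecR; apply: ge_inf; first by exists 0.
  by exists a.
have ere : e = (complex.Re e)%:C%C.
  by case: e e0 => a b; rewrite ltcE /= => /andP[/eqP -> _].
have re0 : 0 < complex.Re e by move: e0; rewrite ltcE /= => /andP[].
have [|_ [a Aa <-] alt] := inf_adherent (E := @complex.Re R @` A) re0.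
  by split; [case: A0 => a Aa; exists (complex.Re a), a | exists 0].
by exists a => //; rewrite (Are a Aa) ere -rmorphD /= ltcR.
Qed.

End Scalars.

Unset Implicit Arguments.

Theorem corollary4p8 (R : realType) (k : scalar_kind)
    (H : hilbertSpace (@scalars_conj R k)) (S : linearOperator H) :
  [<-> essentially_selfadjoint S;
       [/\ densely_defined S, self_wedge S &
         exists lambda : scalars R k, [/\ lambda \is Num.real, lambda != 0 &
           closure (op_range (matrix_op S lambda)) = [set: H * H]]];
       [/\ densely_defined S, self_wedge S &
         forall lambda : scalars R k, lambda \is Num.real -> lambda != 0 ->
           closure (op_range (matrix_op S lambda)) = [set: H * H]];
       [/\ closable S, self_wedge S &
         exists lambda : scalars R k, [/\ lambda \is Num.real, lambda != 0 &
           closure (op_range (matrix_op S lambda)) = [set: H * H]]];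
       [/\ closable S, self_wedge S &
         forall lambda : scalars R k, lambda \is Num.real -> lambda != 0 ->
           closure (op_range (matrix_op S lambda)) = [set: H * H]]].
Proof.
exact: (essentially_selfadjoint_tfae (@sqr_norm_conj R k) (@scalars_inf R k)).
Qed.
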